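(* Let $n$ be a positive integer. Define a double-indexed sequence $G_r(k)$ (integers $r\ge 0$, $k\ge 0$) by $G_r(0)=1$ for all $r$ and, for $k\ge 1$, $$G_r(k)=5\,(n-r-k)\,G_r(k-1)-2\,(n-2r-\delta(n-1))\,G_{r+1}(k-1).$$ Then $$\frac{G_0(\lfloor n/2\rfloor)}{(n-1)(n-2)\cdots(n-\lfloor n/2\rfloor)}=\begin{cases}F(n) & \text{if } n \text{ is odd}\\ L(n) & \text{if } n\text{ is even,}\end{cases}$$ where $F$ is the Fibonacci sequence ($F(0)=0$, $F(1)=1$, $F(m+1)=F(m)+F(m-1)$) and $L$ is the Lucas sequence ($L(0)=2$, $L(1)=1$, $L(m+1)=L(m)+L(m-1)$).
   Context: For an integer $m\ge 0$, $\delta(m)\in\{0,1\}$ is the residue of $m$ modulo $2$. The denominator is $\prod_{j=1}^{\lfloor n/2\rfloor}(n-j)$; an empty product equals $1$. *)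

(* Defs.v *)
From mathcomp Require Import all_boot all_order all_algebra.
Set Implicit Arguments.
Unset Strict Implicit.
Unset Printing Implicit Defensive.
Import GRing.Theory.
Local Open Scope ring_scope.

Definition delta (m : nat) : nat := (m %% 2)%N.

(* [G n r k] is G_r(k).  The factors n - r - k and n - 2r - delta(n-1) may be
   negative, so they are computed in [int].  The predecessor in [n.-1] is the
   true one for n > 0, the only case of interest. *)
Fixpoint G (n r k : nat) {struct k} : int :=
  if k is k'.+1 then
    5 * (n%:Z - r%:Z - k%:Z) * G n r k'
    - 2 * (n%:Z - 2 * r%:Z - (delta n.-1)%:Z) * G n r.+1 k'
  else 1.

Fixpoint fib (m : nat) : nat :=
  match m with
  | 0 => 0
  | 1 => 1
  | (m'.+1 as p).+1 => fib p + fib m'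
  end%N.

Fixpoint lucas (m : nat) : nat :=
  match m with
  | 0 => 2
  | 1 => 1
  | (m'.+1 as p).+1 => lucas p + lucas m'
  end%N.

(* Main.v *)
Require Import Defs.
From mathcomp Require Import all_boot all_order all_algebra.
From mathcomp Require Import zify ring.
Import GRing.Theory.
Local Open Scope ring_scope.

(** Unfolding the recursion, [G n r k] is a sum over the sets of steps at which
    the second term (which raises [r]) is chosen.  A step that raises [r] lowers
    [k], so it leaves the quantity n - r - k of the first term unchanged;
    hence the contribution of such a set depends only on its size j, and
      G_r(k) = sum_j C(k,j) 5^(k-j) (-2)^j
                 prod_(i<j) (n-2r-2i-delta(n-1)) prod_(i<k-j) (n-r-k+i)
    ([G_closed_form]).  At r = 0 and k = m, the half of n, the factors
    2m, 2m-2, ... of 2^j m^_j interleave with those of the first product to give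
    the falling factorial n^_(2j).  So, after division by (n-1)...(n-m), the
    j-th term is (-1)^j 5^(m-j) times n/(n-j) C(n-j,j) ([term_quotient]).

    These numbers are the coefficients of the Lucas polynomials, in which the
    power sum of two numbers is expressed by their sum and product.  Take the
    golden ratio and the opposite of its conjugate, whose sum is the square root
    of 5 and whose product is 1: their n-th power sum is L(n) for n even and
    F(n) times the square root of 5 for n odd.  To avoid the square root, the
    identity is proved by induction: the Pascal-like rule of the coefficients
    yields a recurrence for the sums, which is that of the target numbers, namely
    L(n+2) = 5 F(n+1) - L(n) for n even and F(n+2) = L(n+1) - F(n) for n odd
    ([lucas_sum5]). *)

(** * The Lucas triangle *)

(** The coefficient n/(n-j) C(n-j,j) of the Lucas polynomials, given by its
    Pascal-like rule; the value 2 at n = j = 0 is what makes the rule hold from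
    n = 0 on. *)
Fixpoint lucas_coef (n j : nat) {struct n} : nat :=
  match j, n with
  | 0, 0 => 2
  | 0, _ => 1
  | j'.+1, (n'.+1 as p).+1 => lucas_coef p j + lucas_coef n' j'
  | _, _ => 0
  end%N.

#[local] Arguments lucas_coef : simpl never.

Lemma lucas_coefSS n j :
  lucas_coef n.+2 j.+1 = (lucas_coef n.+1 j.+1 + lucas_coef n j)%N.
Proof. by []. Qed.

Lemma lucas_coef_small n j : (n < j.*2)%N -> lucas_coef n j = 0%N.
Proof.
elim/ltn_ind: n j => -[|[|n]] IH [|j] // h.
by rewrite lucas_coefSS !IH //; lia.
Qed.

Lemma lucas_coef_diag j : lucas_coef j.*2 j = 2%N.
Proof.
by elim: j => // j IH; rewrite doubleS lucas_coefSS IH lucas_coef_small //; lia.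
Qed.

(** Indexing by d = n - 2j turns the rule of the triangle into Pascal's rule in
    (d, j) and keeps the formula free of subtractions. *)
Lemma lucas_coef_fact d j : (0 < d + j)%N ->
  (lucas_coef (d + j.*2) j * d`! * j`! = (d + j.*2) * (d + j).-1`!)%N.
Proof.
elim: j d => [|j IHj] d.
  case: d => // d _.
  by rewrite double0 !addn0 factS fact0 succnK /lucas_coef; lia.
elim: d => [_|d IHd _].
  by rewrite !add0n lucas_coef_diag fact0 factS /=; lia.
have {}IHd := IHd ltac:(by rewrite addnS).
have {}IHj := IHj d.+1 ltac:(by rewrite addSn).
rewrite doubleS !addSn !addnS /= in IHd IHj *; rewrite lucas_coefSS.
rewrite (factS d) (factS j) (factS (d + j)) in IHd IHj *.
set a := lucas_coef _ j.+1 in IHd *; set b := lucas_coef _ j in IHj *.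
have -> : ((a + b) * (d.+1 * d`!) * (j.+1 * j`!) =
  d.+1 * (a * d`! * (j.+1 * j`!)) + j.+1 * (b * (d.+1 * d`!) * j`!))%N by ring.
rewrite IHd IHj -mul2n; ring.
Qed.

(** * Lucas polynomials and the Fibonacci and Lucas numbers *)

(** If p q = 1 and x = (p + q)^2, this is p^n + q^n for even n and
    (p^n + q^n) / (p + q) for odd n: dropping the factor p + q leaves a
    polynomial in x, so that no square root of x is needed. *)
Definition lucas_sum (x : int) (n : nat) : int :=
  \sum_(j < n./2.+1) (-1) ^+ j * (lucas_coef n j)%:Z * x ^+ (n./2 - j).

Lemma lucas_sum_evenSS (x : int) m :
  lucas_sum x m.*2.+2 = x * lucas_sum x m.*2.+1 - lucas_sum x m.*2.
Proof.
rewrite /lucas_sum /= uphalf_double !doubleK.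
have -> : x * \sum_(j < m.+1)
     (-1) ^+ j * (lucas_coef m.*2.+1 j)%:Z * x ^+ (m - j)
  = \sum_(j < m.+2) (-1) ^+ j * (lucas_coef m.*2.+1 j)%:Z * x ^+ (m.+1 - j).
  rewrite [RHS]big_ord_recr /= (@lucas_coef_small _ m.+1); last by lia.
  rewrite mulr0 mul0r addr0 mulr_sumr; apply: eq_bigr => j _.
  have le_jm : (j <= m)%N by rewrite -ltnS.
  rewrite subSn // exprS; ring.
rewrite big_ord_recl [X in _ = X - _]big_ord_recl -addrA; congr (_ + _).
rewrite -sumrB; apply: eq_bigr => j _.
rewrite lift0 lucas_coefSS subSS PoszD exprS; ring.
Qed.

Lemma lucas_sum_oddSS (x : int) m :
  lucas_sum x m.*2.+3 = lucas_sum x m.*2.+2 - lucas_sum x m.*2.+1.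
Proof.
rewrite /lucas_sum /= uphalf_double !doubleK.
rewrite big_ord_recl [X in _ = X - _]big_ord_recl -addrA; congr (_ + _).
rewrite -sumrB; apply: eq_bigr => j _.
rewrite lift0 (lucas_coefSS m.*2.+1) subSS PoszD exprS; ring.
Qed.

Lemma lucasE n : lucas n.+1 = (fib n.+2 + fib n)%N.
Proof.
elim/ltn_ind: n => -[|[|n]] IH //.
have -> : lucas n.+3 = (lucas n.+2 + lucas n.+1)%N by [].
by rewrite !IH //=; lia.
Qed.

(** At x = 5 the even Lucas sums are Lucas numbers and the odd ones are
    Fibonacci numbers, since both satisfy the same alternating recurrence. *)
Lemma lucas_sum5 m :
  lucas_sum 5 m.*2 = (lucas m.*2)%:Z /\ lucas_sum 5 m.*2.+1 = (fib m.*2.+1)%:Z.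
Proof.
elim: m => [|m [IHe IHo]].
  by split; rewrite /lucas_sum big_ord_recl big_ord0.
have He : lucas_sum 5 m.*2.+2 = (lucas m.*2.+2)%:Z.
  rewrite lucas_sum_evenSS IHe IHo.
  case: (m) => // k.
  rewrite doubleS !lucasE /=; lia.
rewrite doubleS He lucas_sum_oddSS He IHo; split=> //.
by rewrite lucasE; lia.
Qed.

Lemma lucas_sum5E n :
  lucas_sum 5 n = (if odd n then fib n else lucas n)%:Z.
Proof.
rewrite -{1}(odd_double_half n); have [He Ho] := lucas_sum5 n./2.
have := odd_double_half n; case: (odd n) => {2}<-.
  by rewrite add1n.
by rewrite add0n.
Qed.

(** * Solving the recursion *)

Definition rising (a : int) (k : nat) : int := \prod_(i < k) (a + i%:Z).

Definition falling2 (b : int) (k : nat) : int := \prod_(i < k) (b - 2 * i%:Z).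

Lemma risingS a k : rising a k.+1 = a * rising (a + 1) k.
Proof.
rewrite /rising big_ord_recl addr0; congr (_ * _); apply: eq_bigr => i _.
by rewrite lift0; lia.
Qed.

Lemma falling2S b k : falling2 b k.+1 = b * falling2 (b - 2) k.
Proof.
rewrite /falling2 big_ord_recl mulr0 subr0; congr (_ * _).
by apply: eq_bigr => i _; rewrite lift0; lia.
Qed.

Definition G_term (n r k j : nat) : int :=
  5 ^+ (k - j) * (-2) ^+ j
    * falling2 (n%:Z - 2 * r%:Z - (delta n.-1)%:Z) j
    * rising (n%:Z - r%:Z - k%:Z) (k - j).

Lemma G_term_keep n r k j : (j <= k)%N ->
  5 * (n%:Z - r%:Z - k.+1%:Z) * G_term n r k j = G_term n r k.+1 j.
Proof.
move=> le_jk; rewrite /G_term subSn // risingS exprS.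
have -> : n%:Z - r%:Z - k.+1%:Z + 1 = n%:Z - r%:Z - k%:Z by lia.
ring.
Qed.

Lemma G_term_raise n r k j :
  - 2 * (n%:Z - 2 * r%:Z - (delta n.-1)%:Z) * G_term n r.+1 k j
  = G_term n r k.+1 j.+1.
Proof.
rewrite /G_term subSS falling2S exprS.
have -> : n%:Z - r.+1%:Z - k%:Z = n%:Z - r%:Z - k.+1%:Z by lia.
have -> : n%:Z - 2 * r.+1%:Z - (delta n.-1)%:Z
  = n%:Z - 2 * r%:Z - (delta n.-1)%:Z - 2 by lia.
ring.
Qed.

(** The binomial coefficient counts the orders of the j raising steps among the
    k steps: they all contribute the same product. *)
Lemma G_closed_form n r k :
  G n r k = \sum_(j < k.+1) 'C(k, j)%:Z * G_term n r k j.
Proof.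
elim: k r => [|k IH] r.
  by rewrite big_ord_recl big_ord0 /G_term /falling2 /rising !big_ord0.
have -> : G n r k.+1 = 5 * (n%:Z - r%:Z - k.+1%:Z) * G n r k
    + - 2 * (n%:Z - 2 * r%:Z - (delta n.-1)%:Z) * G n r.+1 k.
  by rewrite !mulNr.
rewrite !IH !mulr_sumr.
under eq_bigr => j _ do
  rewrite mulrCA G_term_keep -1?ltnS ?ltn_ord //.
under [X in _ + X]eq_bigr => j _ do rewrite mulrCA G_term_raise.
have -> : \sum_(j < k.+1) 'C(k, j)%:Z * G_term n r k.+1 j
  = \sum_(j < k.+2) 'C(k, j)%:Z * G_term n r k.+1 j.
  by rewrite [RHS]big_ord_recr /= bin_small // mul0r addr0.
rewrite big_ord_recl [RHS]big_ord_recl !bin0 -addrA; congr (_ + _).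
rewrite -big_split; apply: eq_bigr => j _.
by rewrite !lift0 binS PoszD mulrDl.
Qed.

(** * The terms at r = 0 and k the half of n *)

Lemma fact_rising t k : t`!%:Z * rising t.+1%:Z k = (t + k)`!%:Z.
Proof.
rewrite /rising; elim: k => [|k IH]; first by rewrite big_ord0 mulr1 addn0.
by rewrite big_ord_recr /= mulrA IH addnS factS; lia.
Qed.

(** The factors of 2^j m^_j have the parity opposite to those of [falling2]:
    together they run through n, n-1, ..., n-2j+1. *)
Lemma ffact_interleave n j : (j <= n./2)%N ->
  2 ^+ j * (n./2 ^_ j)%:Z * falling2 (n%:Z - (delta n.-1)%:Z) j
  = (n ^_ j.*2)%:Z.
Proof.
elim: j => [|j IH] lt_jn; first by rewrite /falling2 big_ord0.
rewrite /falling2 big_ord_recr /= doubleS !ffactnSr exprS.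
rewrite !PoszM -IH 1?ltnW // /falling2.
set p := \prod_(i < j) _.
have Hq : (n - j.*2)%N%:Z * (n - j.*2.+1)%N%:Z
    = 2 * (n./2 - j)%N%:Z * (n%:Z - (delta n.-1)%:Z - 2 * j%:Z).
  have := odd_double_half n; rewrite /delta modn2.
  case: n lt_jn {p IH} => // n lt_jn; rewrite oddS.
  by case: (odd n) => /=; nia.
have -> : 2 ^+ j * (n./2 ^_ j)%:Z * p * (n - j.*2)%N%:Z * (n - j.*2.+1)%N%:Z
  = 2 ^+ j * (n./2 ^_ j)%:Z * p * ((n - j.*2)%N%:Z * (n - j.*2.+1)%N%:Z)
  by ring.
rewrite Hq; ring.
Qed.

(** Read upwards from n - m, the denominator is a rising product of the kind that
    occurs in [G_term], so the two can be compared through factorials. *)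
Lemma denominator_rising n m :
  \prod_(1 <= j < m.+1) (n%:Z - j%:Z) = rising (n%:Z - m%:Z) m.
Proof.
rewrite /rising big_add1 /= big_mkord [RHS](reindex_inj rev_ord_inj).
by apply: eq_bigr => i _ /=; have := ltn_ord i; lia.
Qed.

(** With m the half of n, both sides, multiplied by j! (n-2j)! (n-m-1)!, become
    (-1)^j 5^(m-j) n! (n-j-1)!; the proof thus avoids division. *)
Lemma term_quotient n j : (0 < n)%N -> (j <= n./2)%N ->
  'C(n./2, j)%:Z * G_term n 0 n./2 j
  = (-1) ^+ j * (lucas_coef n j)%:Z * 5 ^+ (n./2 - j)
    * rising (n%:Z - (n./2)%:Z) n./2.
Proof.
move=> n0 le_jm; rewrite /G_term mulr0 !subr0.
have odn := odd_double_half n; have := leq_b1 (odd n) => odn1.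
pose t := (n - n./2).-1.
have -> : n%:Z - (n./2)%:Z = t.+1%:Z by rewrite /t; lia.
pose w : int := (j`! * (n - j.*2)`! * t`!)%N%:Z.
have w0 : w != 0.
  by rewrite /w eqz_nat -lt0n !muln_gt0 !fact_gt0.
apply: (mulfI w0); rewrite /w !PoszM -(mulN1r 2) exprMn.
have Hb : 'C(n./2, j)%:Z * j`!%:Z = (n./2 ^_ j)%:Z by rewrite -PoszM bin_ffact.
have Hf := ffact_interleave _ _ le_jm.
have Hn : (n ^_ j.*2)%:Z * (n - j.*2)`!%:Z = n`!%:Z.
  by rewrite -PoszM ffact_fact //; lia.
have Hr1 := fact_rising t (n./2 - j).
have Hr2 := fact_rising t n./2.
have Hc : (lucas_coef n j)%:Z * (n - j.*2)`!%:Z * j`!%:Z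
    = n%:Z * (t + (n./2 - j))`!%:Z.
  have := @lucas_coef_fact (n - j.*2) j ltac:(lia).
  rewrite subnK; last by lia.
  have -> : ((n - j.*2 + j).-1 = t + (n./2 - j))%N by rewrite /t; lia.
  by move=> E; rewrite -!PoszM E.
have Hnf : n`!%:Z = n%:Z * (t + n./2)`!%:Z.
  have -> : (t + n./2 = n.-1)%N by rewrite /t; lia.
  by rewrite -PoszM -(prednK n0) factS.
set F := falling2 _ _ in Hf *; set R1 := rising _ (_ - _) in Hr1 *.
set R2 := rising _ _ in Hr2 *.
transitivity ((-1) ^+ j * 5 ^+ (n./2 - j) * (n`!%:Z * (t + (n./2 - j))`!%:Z)).
  rewrite -Hn -Hf -Hr1 -Hb; ring.
rewrite Hnf -Hr2.
transitivity ((-1) ^+ j * 5 ^+ (n./2 - j) * (t`!%:Z * R2)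
  * (n%:Z * (t + (n./2 - j))`!%:Z)); first by ring.
rewrite -Hc; ring.
Qed.

Lemma G_half n : (0 < n)%N ->
  G n 0 n./2 = lucas_sum 5 n * \prod_(1 <= j < n./2.+1) (n%:Z - j%:Z).
Proof.
move=> n0; rewrite G_closed_form denominator_rising /lucas_sum mulr_suml.
by apply: eq_bigr => j _; rewrite term_quotient // -ltnS.
Qed.

Theorem theorem9 (n : nat) (hn : (0 < n)%N) :
  (G n 0 (n %/ 2))%:~R / \prod_(1 <= j < (n %/ 2).+1) (n%:R - j%:R)
  = (if odd n then (fib n)%:R else (lucas n)%:R) :> rat.
Proof.
rewrite divn2 G_half // lucas_sum5E rmorphM /= rmorph_prod /=.
under eq_bigr => j _ do rewrite rmorphB /= -!pmulrn.
rewrite mulfK; first by case: ifP; rewrite -pmulrn.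
rewrite prodf_seq_neq0; apply/allP => j; rewrite mem_index_iota => lt_j /=.
by rewrite subr_eq0 Num.Theory.eqr_nat; lia.
Qed.
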